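(* Let $h,k\in\mathbb N\cup(\mathbb N+\tfrac12)$ with $h,k\geq 3$. (1) Suppose that $h<k$. Then every variety with an $h$-near-unanimity term has a $k$-near-unanimity term. Moreover, there is a locally finite variety with a $k$-near-unanimity term and without an $h$-near-unanimity term. (2) Every variety with an $h$-near-unanimity term is $(2h-4)$-distributive. There is a locally finite variety with an $h$-near-unanimity term which is not $(2h-5)$-distributive. (3) Every variety with an $h$-near-unanimity term is $(2h-3)$-modular. If $h\geq 4$, there is a locally finite variety with an $h$-near-unanimity term which is not $(2h-4)$-modular.
   Context: Varieties are classes of algebras (in the sense of universal algebra) of a fixed type defined by equations. Equations displayed below are required to hold identically in the variety, and $x,y,z,w$ are variables. **$h$-near-unanimity term, $h=n$ an integer, $n\ge 3$.** An $n$-ary term $u$ such that all equations $u(x,\dots,x,y,x,\dots,x)=x$ hold, with exactly one occurrence of $y$, in any possible position. **$h$-near-unanimity term, $h=n+\tfrac12$ a half-integer, $n\ge 2$ an integer** (also called an $n\frac12$-near-unanimity term). An $(n+2)$-ary term $u$ such that the following equations hold: - $u(z,z,x,x,\dots,x)=x$; - $u(x,\dots,x,z,x,\dots,x)=x$ with the single $z$ at position $i$, for every $i$ with $2\le i\le n+2$; - $u(x,x,x,z,z,\dots,z)=u(x,z,z,z,z,\dots,z)$ (on the left, $x$ in the first three positions and $z$ elsewhere; on the right, $x$ in the first position and $z$ elsewhere). **$k$-distributive** ($k$ a natural number). A variety is $k$-distributive if it has ternary terms $t_0,\dots,t_k$ (Jónsson terms) satisfying $t_0(x,y,z)=x$;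 $t_i(x,y,x)=x$ for $0\le i\le k$; $t_i(x,x,z)=t_{i+1}(x,x,z)$ for even $i$, $0\le i<k$; $t_i(x,z,z)=t_{i+1}(x,z,z)$ for odd $i$, $0\le i<k$; $t_k(x,y,z)=z$. **$k$-modular** ($k$ a natural number). A variety is $k$-modular if it has $4$-ary terms $t_0,\dots,t_k$ (Day terms) satisfying $t_i(x,y,y,x)=x$ for $0\le i\le k$; $t_0(x,y,z,w)=x$; $t_i(x,x,w,w)=t_{i+1}(x,x,w,w)$ for even $i$, $0\le i<k$; $t_i(x,y,y,w)=t_{i+1}(x,y,y,w)$ for odd $i$, $0\le i<k$; $t_k(x,y,z,w)=w$. A variety is locally finite if each of its finitely generated algebras is finite. *)

(* Defs.v *)
From mathcomp Require Import all_boot.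

Set Implicit Arguments.
Unset Strict Implicit.
Unset Printing Implicit Defensive.

Record signature : Type := Signature {
  op : Type;
  arity : op -> nat }.

Inductive term (S : signature) (X : Type) : Type :=
| Var of X
| App (f : op S) of 'I_(arity f) -> term S X.

Record algebra (S : signature) : Type := Algebra {
  carrier :> Type;
  carrier_nonempty : inhabited carrier;
  interp : forall f : op S, ('I_(arity f) -> carrier) -> carrier }.

Fixpoint eval (S : signature) (A : algebra S) (X : Type) (v : X -> A)
    (t : term S X) : A :=
  match t with
  | Var x => v x
  | App f args => @interp S A f (fun i => eval v (args i))
  end.

Definition evalt (S : signature) (A : algebra S) (n : nat)
    (t : term S 'I_n) (a : n.-tuple A) : A := eval (tnth a) t.

Definition models (S : signature) (A : algebra S)
    (E : term S nat -> term S nat -> Prop) : Prop :=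
  forall l r, E l r -> forall v : nat -> A, eval v l = eval v r.

Record variety (S : signature) : Type := Variety {
  in_variety :> algebra S -> Prop;
  equational : exists E : term S nat -> term S nat -> Prop,
    forall A : algebra S, in_variety A <-> models A E }.

Definition subuniverse (S : signature) (A : algebra S) (P : A -> Prop) : Prop :=
  forall (f : op S) (a : 'I_(arity f) -> A), (forall i, P (a i)) -> P (@interp S A f a).

Definition finitely_generated (S : signature) (A : algebra S) : Prop :=
  exists (n : nat) (g : 'I_n -> A), forall P : A -> Prop,
    subuniverse P -> (forall i, P (g i)) -> forall a, P a.

Definition finite_algebra (S : signature) (A : algebra S) : Prop :=
  exists (n : nat) (e : 'I_n -> A), forall a, exists i, e i = a.

Definition locally_finite (S : signature) (V : variety S) : Prop :=
  forall A : algebra S, V A -> finitely_generated A -> finite_algebra A.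

(* [Whole n] stands for n and [PlusHalf n] for n + 1/2.  Comparisons and the
   expressions 2h - c are taken on the natural number [twice h] = 2h. *)
Inductive half_nat : Type :=
| Whole of nat
| PlusHalf of nat.

Definition twice (h : half_nat) : nat :=
  match h with
  | Whole n => n.*2
  | PlusHalf n => n.*2.+1
  end.

(* Argument positions are numbered from 0 here, from 1 in the usual
   presentation of the equations. *)
Definition whole_near_unanimity (S : signature) (V : variety S) (n : nat)
    (u : term S 'I_n) : Prop :=
  forall A : algebra S, V A -> forall (x y : A) (i : 'I_n),
    evalt u [tuple if j == i then y else x | j < n] = x.

Definition half_near_unanimity (S : signature) (V : variety S) (n : nat)
    (u : term S 'I_n.+2) : Prop :=
  forall A : algebra S, V A -> forall x z : A,
  [/\ evalt u [tuple if j < 2 then z else x | j < n.+2] = x,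
      forall i : 'I_n.+2, 1 <= i ->
        evalt u [tuple if j == i then z else x | j < n.+2] = x
    & evalt u [tuple if j < 3 then x else z | j < n.+2] =
      evalt u [tuple if j < 1 then x else z | j < n.+2]].

Definition has_near_unanimity (h : half_nat) (S : signature) (V : variety S) :
    Prop :=
  match h with
  | Whole n => exists u : term S 'I_n, whole_near_unanimity V u
  | PlusHalf n => exists u : term S 'I_n.+2, half_near_unanimity V u
  end.

Definition distributive (k : nat) (S : signature) (V : variety S) : Prop :=
  exists t : nat -> term S 'I_3, forall A : algebra S, V A ->
  [/\ forall x y z : A, evalt (t 0) [tuple x; y; z] = x,
      forall i, i <= k -> forall x y : A, evalt (t i) [tuple x; y; x] = x,
      forall i, i < k -> ~~ odd i -> forall x z : A,
        evalt (t i) [tuple x; x; z] = evalt (t i.+1) [tuple x; x; z],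
      forall i, i < k -> odd i -> forall x z : A,
        evalt (t i) [tuple x; z; z] = evalt (t i.+1) [tuple x; z; z]
    & forall x y z : A, evalt (t k) [tuple x; y; z] = z].

Definition modular (k : nat) (S : signature) (V : variety S) : Prop :=
  exists t : nat -> term S 'I_4, forall A : algebra S, V A ->
  [/\ forall i, i <= k -> forall x y : A, evalt (t i) [tuple x; y; y; x] = x,
      forall x y z w : A, evalt (t 0) [tuple x; y; z; w] = x,
      forall i, i < k -> ~~ odd i -> forall x w : A,
        evalt (t i) [tuple x; x; w; w] = evalt (t i.+1) [tuple x; x; w; w],
      forall i, i < k -> odd i -> forall x y w : A,
        evalt (t i) [tuple x; y; y; w] = evalt (t i.+1) [tuple x; y; y; w]
    & forall x y z w : A, evalt (t k) [tuple x; y; z; w] = w].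

(* Main.v *)
Require Import Defs.
From mathcomp Require Import all_boot.
From mathcomp Require Import zify.
From Stdlib Require Import FunctionalExtensionality Classical.

(** Both bounds come from one quantity that a near-unanimity term lets grow by
    one every two steps, and that nothing lets grow faster.

    Upper bounds.  The near-unanimity identities say that u(x, ..., x, z) = x
    and u(x, z, ..., z) = z.  Moving the border between the x's and the z's one
    position to the left costs one step along y = x and one step along y = z if
    the variable at the border is [y]; this is Mitschke's chain, and it gives
    2n - 4 Jonsson steps, or 2n - 3 Day steps, for an n-ary term.  For
    h = n + 1/2 the term has n + 2 places; the identity
    u(x, x, x, z, ...) = u(x, z, ...) jumps from three x's to a single one,
    and the chain is finished with u(z, z, x, ...) = x.

    Lower bounds.  Interpret an M-ary operation on the two-element set by
    a |-> (at most e + 1 coordinates of [a] are false), simultaneously for all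
    thresholds e < N.  In algebra e the operation describes a family F_e of
    subsets of its M places.  Missing places add up under intersection, so a
    member of F_e meets a member of F_0 in a member of F_{e+1}
    ([graded_meet]), and three members, of F_{K-1}, F_0 and F_0, always have a
    common place ([graded_inter]).  These facts pass from the operation to all
    terms.  For Jonsson terms t_i, let Q_i(e) and P_i(e) be the truth values of
    t_i(0,1,1) and t_i(0,0,1) in algebra e.  As t_i(1,0,1) = 1 in algebra 0,
    intersecting places gives Q_i(e) -> P_i(e+1), while P_i(e) -> Q_i(e) by
    monotonicity.  A step of the chain changes only Q or only P, so two steps
    are needed for each e between K - 1 and 0
    ([filter_not_distributive]); Day terms are treated alike with three truth
    values ([filter_not_modular]).

    For h = n the filters count the false coordinates.  For h = n + 1/2 they
    count them after the first two coordinates have been replaced by their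
    conjunction, which realizes u(z, z, x, ...) = x; the filter F_0 moreover
    leaves out the tuple that is false exactly at the first place, because the
    exchange identity ties it to the tuple false at the first three places.
    So F_0 is not monotone ([half_threshold]), which costs one step compared
    with the bound for n + 1, that is, half a unit of h.

    Finally, the strictness of the hierarchy follows from the exactness of the
    Jonsson bounds 2h - 4. *)

Set Implicit Arguments.
Unset Strict Implicit.
Unset Printing Implicit Defensive.

(** * Terms and substitution of variables *)

Lemma eval_ext (S : signature) (A : algebra S) (X : Type) (v w : X -> A)
    (t : term S X) :
  v =1 w -> eval v t = eval w t.
Proof. by move=> /functional_extensionality ->. Qed.

Fixpoint rename (S : signature) (X Y : Type) (g : X -> Y) (t : term S X) :
    term S Y :=
  match t with
  | Var x => Var S (g x)
  | App f args => App (fun i => rename g (args i))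
  end.

Lemma eval_rename (S : signature) (A : algebra S) (X Y : Type) (g : X -> Y)
    (v : Y -> A) (t : term S X) :
  eval v (rename g t) = eval (v \o g) t.
Proof.
elim: t => [x|f args IH] //=; congr interp.
by apply: functional_extensionality => i; apply: IH.
Qed.

Lemma evalt_mktuple (S : signature) (A : algebra S) (n : nat) (F : 'I_n -> A)
    (t : term S 'I_n) :
  evalt t [tuple F j | j < n] = eval F t.
Proof. by apply: eval_ext => i; rewrite tnth_mktuple. Qed.

(** The pattern (x, ..., x, y, z, ..., z) with [y] at position [c]; the terms
    witnessing distributivity and modularity all have this shape. *)
Definition block (X : Type) (M c : nat) (x y z : X) (p : 'I_M) : X :=
  if p < c then x else if p == c :> nat then y else z.

Lemma evalt_block (S : signature) (A : algebra S) (M m c : nat)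
    (a : m.-tuple A) (i j k : 'I_m) (u : term S 'I_M) :
  evalt (rename (block c i j k) u) a
  = eval (block c (tnth a i) (tnth a j) (tnth a k)) u.
Proof.
rewrite /evalt eval_rename; apply: eval_ext => p /=; rewrite /block.
by do 2?case: ifP.
Qed.

Lemma block_shift (X : Type) (M c : nat) (x z : X) :
  0 < c -> @block X M c.-1 x x z =1 block c x z z.
Proof.
move=> c_gt0 p; rewrite /block.
case: (ltngtP p c.-1) => h1; case: (ltngtP p c) => h2 //; lia.
Qed.

(** * Near-unanimity identities, freed from tuples *)

(** The value of [F] at the place [i] is arbitrary; [i] is a number, so that the
    places of the moving border can be computed without ordinal casts. *)
Definition absorbs_at (S : signature) (V : variety S) (n : nat)
    (u : term S 'I_n) (i : nat) : Prop :=
  forall A : algebra S, V A -> forall (F : 'I_n -> A) (x : A),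
    (forall j : 'I_n, j != i :> nat -> F j = x) -> eval F u = x.

Lemma whole_absorbs (S : signature) (V : variety S) (n : nat)
    (u : term S 'I_n) (i : nat) :
  whole_near_unanimity V u -> i < n -> absorbs_at V u i.
Proof.
move=> nu lin A VA F x Fx.
rewrite -[RHS](nu A VA x (F (Ordinal lin)) (Ordinal lin)) evalt_mktuple.
by apply: eval_ext => j; case: eqP => [->|/eqP /Fx].
Qed.

Lemma half_absorbs (S : signature) (V : variety S) (n : nat)
    (u : term S 'I_n.+2) (i : nat) :
  half_near_unanimity V u -> 0 < i < n.+2 -> absorbs_at V u i.
Proof.
move=> nu /andP[i_gt0 lin] A VA F x Fx.
case: (nu A VA x (F (Ordinal lin))) => _ /(_ (Ordinal lin) i_gt0) <- _.
rewrite evalt_mktuple.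
by apply: eval_ext => j; case: eqP => [->|/eqP /Fx].
Qed.

Lemma half_absorbs_pair (S : signature) (V : variety S) (n : nat)
    (u : term S 'I_n.+2) (A : algebra S) (x z : A) :
  half_near_unanimity V u -> V A -> eval (block 1 x x z) u = z.
Proof.
move=> nu VA; case: (nu A VA z x) => E _ _.
rewrite -[RHS]E evalt_mktuple.
by apply: eval_ext => -[[|[|j]] lj].
Qed.

Lemma half_exchange (S : signature) (V : variety S) (n : nat)
    (u : term S 'I_n.+2) (A : algebra S) (x z : A) :
  half_near_unanimity V u -> V A ->
  eval (block 3 x z z) u = eval (block 1 x z z) u.
Proof.
move=> nu VA; case: (nu A VA x z) => _ _; rewrite !evalt_mktuple => E.
by etransitivity; [etransitivity; [|exact: E]|];
  apply: eval_ext => j; rewrite /block; case: ltnP; rewrite ?if_same.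
Qed.

(** * Weakening near-unanimity *)

(** Forget the first two places: then both sides of the exchange identity
    reduce to [z]. *)
Lemma whole_to_half (S : signature) (V : variety S) (n : nat) :
  0 < n -> has_near_unanimity (Whole n) V -> has_near_unanimity (PlusHalf n) V.
Proof.
move=> n_gt0 [u nu]; exists (rename (fun p => rshift 2 p) u) => A VA x z.
have E (F : 'I_n.+2 -> A) : evalt (rename (fun p => rshift 2 p) u)
    [tuple F j | j < n.+2] = eval (fun p => F (rshift 2 p)) u.
  by rewrite evalt_mktuple eval_rename.
have C := whole_absorbs nu n_gt0 VA.
split=> [|i i_gt0|]; rewrite ?E.
- exact: C.
- case: (ltnP i 2) => i2.
    apply: C => j _; case: eqP => // /(congr1 val) /=; lia.
  have lt_i : i - 2 < n by case: i i2 {i_gt0} => /= i; lia.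
  apply: (whole_absorbs nu lt_i VA) => j jn; case: eqP => // /(congr1 val) /=.
  by move: jn => /eqP; lia.
- transitivity z; [apply: C => j | symmetry; apply: C => j].
    by move=> j0; case: ltnP => //=; move: j0 => /eqP /=; lia.
  by move=> _; case: ltnP.
Qed.

(** Identify the first two places: the defect of the half-integer identities at
    the first place alone disappears. *)
Lemma half_to_whole (S : signature) (V : variety S) (n : nat) :
  has_near_unanimity (PlusHalf n) V -> has_near_unanimity (Whole n.+1) V.
Proof.
move=> [u nu]; pose g (p : 'I_n.+2) : 'I_n.+1 := inord p.-1.
have gE (p : 'I_n.+2) : g p = p.-1 :> nat.
  by rewrite /g inordK //; case: p => /= p; lia.
exists (rename g u) => A VA x y i; rewrite /evalt eval_rename.
case: (posnP i) => [i0|i_gt0].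
  rewrite -[RHS](half_absorbs_pair y x nu VA); apply: eval_ext => p /=.
  rewrite tnth_mktuple /block -(inj_eq val_inj) /= gE i0.
  by case: p => -[|[|p]].
have lt_i : 0 < i.+1 < n.+2 by case: i {i_gt0}.
apply: (half_absorbs nu lt_i VA) => p /eqP pi /=.
rewrite tnth_mktuple -(inj_eq val_inj) /= gE; case: eqP => //; lia.
Qed.

(** Inverse of [twice]: doubled indices turn the passage from [h] to
    h + 1/2 into a successor. *)
Definition half_of (m : nat) : half_nat :=
  if odd m then PlusHalf m./2 else Whole m./2.

Lemma twiceK : cancel twice half_of.
Proof.
by case=> n; rewrite /half_of /= odd_double ?doubleK // uphalf_double.
Qed.

Lemma near_unanimity_weaken (S : signature) (V : variety S) (h k : half_nat) :
  2 <= twice h -> twice h <= twice k ->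
  has_near_unanimity h V -> has_near_unanimity k V.
Proof.
rewrite -{3}(twiceK h) -{2}(twiceK k) => h2 /subnKC <-.
elim: (twice k - twice h) => [|d IH] nu; first by rewrite addn0.
rewrite addnS; move: (IH nu); set m := twice h + d.
have m2 : 2 <= m by lia.
rewrite /half_of /=; case: ifP => m_odd.
  rewrite uphalf_half m_odd add1n; exact: half_to_whole.
rewrite uphalf_half m_odd; apply: whole_to_half; lia.
Qed.

(** * Jonsson and Day terms from near-unanimity *)

Local Notation o3 i := (@Ordinal 3 i isT).
Local Notation o4 i := (@Ordinal 4 i isT).

(** The border starts at the last place and is moved left at each even index.
    At odd indices the border variable is [y], which both links of the
    chain can reach; at even indices it is the last variable for Jonsson terms,
    and the third one for Day terms. *)
Definition descent3 (S : signature) (M : nat) (u : term S 'I_M) (i : nat) :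
    term S 'I_3 :=
  rename (block (M.-1 - uphalf i)
            (o3 0) (if odd i then o3 1 else o3 2) (o3 2)) u.

Definition descent4 (S : signature) (M : nat) (u : term S 'I_M) (i : nat) :
    term S 'I_4 :=
  rename (block (M.-1 - uphalf i)
            (o4 0) (if odd i then o4 1 else o4 2) (o4 3)) u.

Lemma descent3E (S : signature) (A : algebra S) (M i : nat) (u : term S 'I_M)
    (x y z : A) :
  evalt (descent3 u i) [tuple x; y; z] =
  eval (block (M.-1 - uphalf i) x (if odd i then y else z) z) u.
Proof. by rewrite evalt_block; case: (odd i). Qed.

Lemma descent4E (S : signature) (A : algebra S) (M i : nat) (u : term S 'I_M)
    (x y z w : A) :
  evalt (descent4 u i) [tuple x; y; z; w] =
  eval (block (M.-1 - uphalf i) x (if odd i then y else z) w) u.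
Proof. by rewrite evalt_block; case: (odd i). Qed.

Lemma absorbs_block (S : signature) (V : variety S) (M c : nat)
    (u : term S 'I_M) (A : algebra S) (x y : A) :
  absorbs_at V u c -> V A -> eval (block c x y x) u = x.
Proof.
move=> uc VA; apply: (uc A VA) => j /negPf jc.
by rewrite /block jc if_same.
Qed.

Lemma absorbs_last (S : signature) (V : variety S) (M : nat)
    (u : term S 'I_M) (A : algebra S) (x y z : A) :
  absorbs_at V u M.-1 -> V A -> eval (block M.-1 x y z) u = x.
Proof.
move=> uc VA; apply: (uc A VA) => j /negPf jc.
by rewrite /block jc; case: ifP => //; case: j jc => /= j; lia.
Qed.

Lemma descent_shift (S : signature) (A : algebra S) (M i : nat)
    (u : term S 'I_M) (x z : A) :
  uphalf i < M.-1 -> ~~ odd i ->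
  eval (block (M.-1 - uphalf i) x z z) u =
  eval (block (M.-1 - uphalf i.+1) x x z) u.
Proof.
move=> lt_i i_even.
have -> : M.-1 - uphalf i.+1 = (M.-1 - uphalf i).-1 by lia.
by apply: eval_ext => p; rewrite block_shift //; lia.
Qed.

Lemma descent_same (M i : nat) :
  odd i -> M.-1 - uphalf i.+1 = M.-1 - uphalf i.
Proof. lia. Qed.

Lemma whole_distributive (S : signature) (V : variety S) (n : nat) :
  3 <= n -> has_near_unanimity (Whole n) V -> distributive (n.*2 - 4) V.
Proof.
move=> n3 [u nu]; exists (descent3 u) => A VA.
have ab c : c < n -> absorbs_at V u c by exact: whole_absorbs.
split=> [x y z|i ik x y|i ik i_even x z|i ik i_odd x z|x y z];
  rewrite !descent3E.
- by rewrite subn0 (absorbs_last _ _ _ (ab _ _) VA) //; lia.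
- by case: (odd i); rewrite (absorbs_block _ _ (ab _ _) VA) //; lia.
- by rewrite /= (negPf i_even) /= descent_shift //; lia.
- by rewrite !if_same descent_same.
- have -> : n.-1 - uphalf (n.*2 - 4) = 1 by lia.
  have -> : odd (n.*2 - 4) = false by lia.
  apply: (ab 0); first lia; move=> // j.
  by rewrite /block; case: j => -[|[|j]].
Qed.

(** The descent is stopped when the border is at place 3, where the exchange
    identity leads to u(x, z, ..., z); there u(x, y, z, ..., z) is a link to the
    last projection. *)
Lemma half_distributive (S : signature) (V : variety S) (n : nat) :
  3 <= n -> has_near_unanimity (PlusHalf n) V -> distributive (n.*2 - 3) V.
Proof.
move=> n3 [u nu].
exists (fun i => if i < n.*2 - 4 then descent3 u i
                 else if i == n.*2 - 4
                 then rename (block 1 (o3 0) (o3 1) (o3 2)) u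
                 else Var S (o3 2)) => A VA.
have ab c : 0 < c < n.+2 -> absorbs_at V u c by exact: half_absorbs.
split=> [x y z|i ik x y|i ik i_even x z|i ik i_odd x z|x y z].
- rewrite ifT; last lia.
  by rewrite descent3E subn0 (absorbs_last _ _ _ (ab _ _) VA) //; lia.
- case: ltngtP => hi //.
    by rewrite descent3E; case: (odd i);
      rewrite (absorbs_block _ _ (ab _ _) VA) //; lia.
  by rewrite evalt_block (absorbs_block _ _ (ab _ _) VA).
- case: (ltngtP i (n.*2 - 4)) => hi; last 2 [lia].
    rewrite ifT; last lia.
    by rewrite !descent3E /= (negPf i_even) /= descent_shift //; lia.
  rewrite !ifF; [|lia..].
  by rewrite evalt_block (half_absorbs_pair _ _ nu VA).
- rewrite ifT; last lia.
  case: (ltngtP i.+1 (n.*2 - 4)) => hi; last 2 [lia].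
    by rewrite !descent3E !if_same descent_same.
  rewrite descent3E evalt_block i_odd.
  have -> : n.+2.-1 - uphalf i = 3 by lia.
  exact: half_exchange nu VA.
- by rewrite !ifF //; lia.
Qed.

Lemma whole_modular (S : signature) (V : variety S) (n : nat) :
  3 <= n -> has_near_unanimity (Whole n) V -> modular (n.*2 - 3) V.
Proof.
move=> n3 [u nu]; exists (descent4 u) => A VA.
have ab c : c < n -> absorbs_at V u c by exact: whole_absorbs.
split=> [i ik x y|x y z w|i ik i_even x w|i ik i_odd x y w|x y z w];
  rewrite !descent4E.
- by rewrite if_same (absorbs_block _ _ (ab _ _) VA) //; lia.
- by rewrite subn0 (absorbs_last _ _ _ (ab _ _) VA) //; lia.
- by rewrite /= (negPf i_even) /= descent_shift //; lia.
- by rewrite !if_same descent_same.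
- have -> : n.-1 - uphalf (n.*2 - 3) = 0 by lia.
  apply: (ab 0); first lia; move=> // j.
  by rewrite /block; case: j => -[|j].
Qed.

(** As for Jonsson terms, but the last link is u(y, z, w, ..., w): it equals
    u(x, w, ..., w) for x = y and z = w, and [w] for y = z. *)
Lemma half_modular (S : signature) (V : variety S) (n : nat) :
  3 <= n -> has_near_unanimity (PlusHalf n) V -> modular (n.*2 - 2) V.
Proof.
move=> n3 [u nu].
exists (fun i => if i < n.*2 - 3 then descent4 u i
                 else if i == n.*2 - 3
                 then rename (block 1 (o4 1) (o4 2) (o4 3)) u
                 else Var S (o4 3)) => A VA.
have ab c : 0 < c < n.+2 -> absorbs_at V u c by exact: half_absorbs.
split=> [i ik x y|x y z w|i ik i_even x w|i ik i_odd x y w|x y z w].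
- case: ltngtP => hi //.
    by rewrite descent4E if_same (absorbs_block _ _ (ab _ _) VA) //; lia.
  by rewrite evalt_block (half_absorbs_pair _ _ nu VA).
- rewrite ifT; last lia.
  by rewrite descent4E subn0 (absorbs_last _ _ _ (ab _ _) VA) //; lia.
- rewrite ifT; last lia.
  case: (ltngtP i.+1 (n.*2 - 3)) => hi; last 2 [lia].
    by rewrite !descent4E /= (negPf i_even) /= descent_shift //; lia.
  rewrite descent4E evalt_block (negPf i_even).
  have -> : n.+2.-1 - uphalf i = 3 by lia.
  exact: half_exchange nu VA.
- case: (ltngtP i (n.*2 - 3)) => hi; last 2 [lia].
    rewrite ifT; last lia.
    by rewrite !descent4E !if_same descent_same.
  rewrite !ifF; [|lia..].
  by rewrite evalt_block (half_absorbs_pair _ _ nu VA).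
- by rewrite !ifF //; lia.
Qed.

(** * Varieties generated by finitely many finite algebras *)

(** The algebras of the family share their carrier, so that a term has a table
    in one finite type. *)
Section GeneratedVariety.

Context (S : signature) (I : Type) (C : Type) (c0 : C).
Context (ops : I -> forall f : op S, ('I_(arity f) -> C) -> C).

Definition family_algebra (i : I) : algebra S := Algebra (inhabits c0) (@ops i).

Definition family_identity (l r : term S nat) : Prop :=
  forall (i : I) (v : nat -> family_algebra i), eval v l = eval v r.

Definition generated_variety : variety S :=
  @Variety S (fun A => models A family_identity)
    (ex_intro (fun E => forall A, models A family_identity <-> models A E)
       family_identity (fun A => iff_refl _)).

Lemma generated_variety_family (i : I) : generated_variety (family_algebra i).
Proof. by move=> l r; apply. Qed.

(** Varieties are defined by identities over [nat]; variables of any countable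
    type can be encoded there, at the cost of a default value. *)
Lemma generated_identity (X : countType) (l r : term S X) :
  (forall (i : I) (v : X -> family_algebra i), eval v l = eval v r) ->
  forall A : algebra S, generated_variety A ->
  forall v : X -> A, eval v l = eval v r.
Proof.
move=> lr A VA v; case: (carrier_nonempty A) => a0.
pose v' k := oapp v a0 (unpickle k).
have E t : eval v t = eval v' (rename pickle t).
  by rewrite eval_rename; apply: eval_ext => x; rewrite /v' /= pickleK.
rewrite !E; apply: (VA) => i w; rewrite !eval_rename; exact: lr.
Qed.

End GeneratedVariety.

Lemma generated_elements (S : signature) (A : algebra S) (n : nat)
    (g : 'I_n -> A) :
  (forall P : A -> Prop, subuniverse P -> (forall i, P (g i)) ->
    forall a, P a) ->
  forall a, exists t : term S 'I_n, eval g t = a.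
Proof.
apply=> [f a /fin_all_exists [t ta]|i]; last by exists (Var S i).
exists (App t) => /=; congr interp; exact: functional_extensionality.
Qed.

(** A term in [n] variables acts on an algebra of the variety through the
    table of its values on the family, and there are finitely many tables. *)
Lemma generated_variety_locally_finite (S : signature) (I C : finType) (c0 : C)
    (ops : I -> forall f : op S, ('I_(arity f) -> C) -> C) :
  locally_finite (generated_variety c0 ops).
Proof.
move=> A VA [n [g /generated_elements gen]].
case: (carrier_nonempty A) => a0.
pose table (t : term S 'I_n) : {ffun I * {ffun 'I_n -> C} -> C} :=
  [ffun p : I * {ffun 'I_n -> C} =>
     eval (p.2 : 'I_n -> family_algebra c0 ops p.1) t].
have tableP s t : table s = table t -> eval g s = eval g t.
  move=> st; apply: (generated_identity _ VA) => i v.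
  move/ffunP/(_ (i, [ffun j => v j])): st; rewrite !ffunE /=.
  by rewrite !(@eval_ext _ _ _ [ffun j => v j] v) // => j; rewrite ffunE.
have [e eP] : exists e : 'I_#|{ffun I * {ffun 'I_n -> C} -> C}| -> A,
    forall k t, table t = enum_val k -> eval g t = e k.
  apply: (fin_all_exists
    (P := fun k a => forall t, table t = enum_val k -> eval g t = a)) => k.
  case: (classic (exists t, table t = enum_val k)) => [[t tk]|no_t].
    by exists (eval g t) => s sk; apply: tableP; rewrite sk tk.
  by exists a0 => t tk; case: no_t; exists t.
exists #|{ffun I * {ffun 'I_n -> C} -> C}|, e => a.
have [t <-] := gen a; exists (enum_rank (table t)).
by rewrite -(eP _ t) ?enum_rankK.
Qed.

(** * Graded filters and the two-element algebras that they define *)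

(** [F e a] reads: the set of places where [a] is true is large of grade [e].
    There are [K] grades before three large sets can miss each other.  The bound
    [e0] is the first grade required to be monotone: it is 0 for integers and 1
    for half-integers, where the bottom grade fails to be. *)
Record graded_filter (M K e0 : nat) (F : nat -> ('I_M -> bool) -> bool) :
    Prop := GradedFilter {
  graded_mono : forall e a b, e0 <= e ->
    (forall i, a i ==> b i) -> F e a ==> F e b;
  graded_meet : forall e a b c,
    (forall i, a i && b i ==> c i) -> F e a && F 0 b ==> F e.+1 c;
  graded_inter : forall a b c, 0 < K ->
    (forall i, ~~ [&& a i, b i & c i]) -> ~~ [&& F K.-1 a, F 0 b & F 0 c] }.

Definition one_op (M : nat) : signature := @Signature unit (fun => M).

Section FilterAlgebras.

Context (M : nat) (F : nat -> ('I_M -> bool) -> bool).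

Definition filter_ops (N : nat) (e : 'I_N) (f : op (one_op M))
  (a : 'I_(arity f) -> bool) : bool := F e a.

Definition filter_variety (N : nat) : variety (one_op M) :=
  generated_variety true (@filter_ops N).

Definition filter_algebra (e : nat) : algebra (one_op M) :=
  Algebra (inhabits true) (fun f : op (one_op M) => F e).

Definition basic_term : term (one_op M) 'I_M :=
  @App (one_op M) 'I_M tt (@Var (one_op M) 'I_M).

Lemma filter_variety_algebra (N e : nat) :
  e < N -> filter_variety N (filter_algebra e).
Proof.
move=> eN.
exact: (@generated_variety_family _ _ _ true (@filter_ops N) (Ordinal eN)).
Qed.

Lemma filter_variety_locally_finite (N : nat) :
  locally_finite (filter_variety N).
Proof. exact: generated_variety_locally_finite. Qed.

(** Identities in two variables are checked on boolean valuations; the set of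
    places that carry the second variable is given as a boolean function. *)
Lemma filter_identity (N : nat) (g1 g2 : 'I_M -> bool) :
  (forall e, e < N -> forall v : bool -> bool, F e (v \o g1) = F e (v \o g2)) ->
  forall A, filter_variety N A -> forall x y : A,
    eval (fun j => if g1 j then y else x) basic_term =
    eval (fun j => if g2 j then y else x) basic_term.
Proof.
move=> FE A VA x y; pose v b := if b then y else x.
rewrite -[LHS]/(eval (v \o g1) basic_term) -[RHS]/(eval (v \o g2) basic_term).
rewrite -!eval_rename; apply: (generated_identity _ VA) => e w.
exact: (FE e (ltn_ord e) w).
Qed.

Lemma filter_absorption (N : nat) (g : 'I_M -> bool) :
  (forall e, e < N -> forall v : bool -> bool, F e (v \o g) = v false) ->
  forall A, filter_variety N A -> forall x y : A,
    eval (fun j => if g j then y else x) basic_term = x.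
Proof.
move=> FE A VA x y; pose v b := if b then y else x.
rewrite -[LHS]/(eval (v \o g) basic_term).
rewrite -[RHS]/(eval v (Var (one_op M) false)).
rewrite -eval_rename; apply: (generated_identity _ VA) => e w.
exact: (FE e (ltn_ord e) w).
Qed.

Context (K e0 : nat) (gF : graded_filter K e0 F).

(** Each clause of [graded_filter] says that a relation between algebras of the
    family is compatible with the operation, hence it passes to all terms. *)
Lemma term_mono (X : Type) (t : term (one_op M) X) (e : nat) (v w : X -> bool) :
  e0 <= e -> (forall x, v x ==> w x) ->
  @eval _ (filter_algebra e) _ v t ==> @eval _ (filter_algebra e) _ w t.
Proof.
by move=> ee vw; elim: t => [x|f args IH] //=; apply: (graded_mono gF).
Qed.

Lemma term_meet (X : Type) (t : term (one_op M) X) (e : nat)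
    (v w r : X -> bool) :
  (forall x, v x && w x ==> r x) ->
  @eval _ (filter_algebra e) _ v t && @eval _ (filter_algebra 0) _ w t ==>
  @eval _ (filter_algebra e.+1) _ r t.
Proof.
by move=> vwr; elim: t => [x|f args IH] //=; apply: (graded_meet gF).
Qed.

Lemma term_inter (X : Type) (t : term (one_op M) X) (v w r : X -> bool) :
  0 < K -> (forall x, ~~ [&& v x, w x & r x]) ->
  ~~ [&& @eval _ (filter_algebra K.-1) _ v t,
         @eval _ (filter_algebra 0) _ w t
       & @eval _ (filter_algebra 0) _ r t].
Proof.
by move=> K0 vwr; elim: t => [x|f args IH] //=; apply: (graded_inter gF).
Qed.

End FilterAlgebras.

(** * Lower bounds on the length of Jonsson and Day chains *)

Section LowerBounds.

Context (M K e0 N : nat) (F : nat -> ('I_M -> bool) -> bool).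
Context (gF : graded_filter K e0 F) (e0_le1 : e0 <= 1) (K_gt0 : 0 < K)
        (KN : K <= N).

Local Notation ev e s a := (@evalt _ (filter_algebra F e) _ s a).

(** By induction on [r], the value Q at grade K - 1 - r stays false up to index
    2r + 2.  The start r = 0 uses three places: for i = 1, {y, z}, {x, z} and
    {x, y} would all be large, of grades K - 1, 0 and 0, without a common
    element. *)
Lemma filter_not_distributive (k : nat) :
  k <= K.*2.+1 - e0 -> ~ distributive k (filter_variety F N).
Proof.
move=> k_le [t tP].
have tA e : e < K -> _ :=
  fun eK => tP (filter_algebra F e)
               (@filter_variety_algebra _ F _ _ (leq_trans eK KN)).
pose P i e := ev e (t i) [tuple false; false; true].
pose Q i e := ev e (t i) [tuple false; true; true].
have t0E e x y z : e < K -> ev e (t 0) [tuple x; y; z] = x.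
  by move=> /tA[].
have endE x y z : ev 0 (t k) [tuple x; y; z] = z by case: (tA 0 K_gt0).
have xyx i e x y : e < K -> i <= k -> ev e (t i) [tuple x; y; x] = x.
  by move=> /tA[_ tB _ _ _] /tB.
have P_even i e : e < K -> i < k -> ~~ odd i -> P i.+1 e = P i e.
  by move=> /tA[_ _ tB _ _] ik /(tB _ ik) /(_ false true).
have Q_odd i e : e < K -> i < k -> odd i -> Q i.+1 e = Q i e.
  by move=> /tA[_ _ _ tB _] ik /(tB _ ik) /(_ false true).
have PQ i e : e0 <= e -> P i e ==> Q i e.
  by move=> ee; apply: (term_mono gF) => //; case; do 3?case.
have QP i e : e.+1 < K -> i <= k -> Q i e ==> P i e.+1.
  move=> eK ik.
  have : Q i e && ev 0 (t i) [tuple true; false; true] ==> P i e.+1.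
    by apply: (term_meet gF); case; do 3?case.
  by rewrite xyx // andbT.
have Q_start i : i <= k -> i <= 2 -> ~~ Q i K.-1.
  suff Q1 : 0 < k -> ~~ Q 1 K.-1.
    case: i => [|[|[|//]]] ik _;
      [rewrite /Q t0E|exact: Q1|rewrite Q_odd ?Q1] => //; lia.
  move=> k_gt0.
  have xxz : ev 0 (t 1) [tuple true; true; false] = true.
    by have [_ _ <- // _ _] := tA 0 K_gt0; apply: t0E.
  have : ~~ [&& Q 1 K.-1, ev 0 (t 1) [tuple true; true; false]
              & ev 0 (t 1) [tuple true; false; true]].
    by apply: (term_inter gF) => //; case; do 3?case.
  by rewrite xxz xyx // !andbT.
have Q_late r i : r < K -> i <= k -> i <= r.*2.+2 -> ~~ Q i (K.-1 - r).
  elim: r i => [|r IH] i rK ik ir; first by rewrite subn0; apply: Q_start.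
  have Q_shift j : j <= k -> j <= r.*2.+3 -> ~~ Q j (K.-1 - r.+1).
    move=> jk jr; have PE j' : j' <= k -> j' <= r.*2.+2 -> ~~ P j' (K.-1 - r).
      move=> j'k j'r; apply: contra (IH j' (ltnW rK) j'k j'r); apply/implyP.
      apply: PQ; lia.
    have eS : (K.-1 - r.+1).+1 = K.-1 - r by lia.
    have {}PE : ~~ P j (K.-1 - r).
      case: (leqP j r.*2.+2) => [|j_gt]; first exact: PE.
      have -> : j = r.*2.+2.+1 by lia.
      by rewrite P_even ?PE //=; lia.
    apply: contra PE; rewrite -eS; apply/implyP; apply: QP => //; lia.
  case: (leqP i r.*2.+3) => [|i_gt]; first exact: Q_shift.
  have -> : i = r.*2.+3.+1 by lia.
  by rewrite Q_odd ?Q_shift //=; lia.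
have Q0 i : i <= k -> i <= K.*2 -> ~~ Q i 0.
  move=> ik iK; rewrite -(subnn K.-1); apply: Q_late; lia.
(* Index 2K + 1 is only allowed when grade 0 is monotone, and then P at grade 0
   is still false there. *)
case: (leqP k K.*2) => [k_small|k_big].
  by have := Q0 k (leqnn k) k_small; rewrite /Q endE.
have kE : k = K.*2.+1 by lia.
have : P K.*2 0.
  by rewrite -P_even -?kE ?/P ?endE ?odd_double; lia.
have e0_eq : e0 <= 0 by lia.
move/(implyP (PQ _ _ e0_eq)); apply/negP; apply: Q0; lia.
Qed.

(** With values of t_i(0,1,1,1), t_i(0,0,1,1) and t_i(0,0,0,1), the induction is
    that of the Jonsson case; each grade now delays R by two steps beyond Q.
    If the bottom grade is not monotone, P at grade 0 is bounded through R at
    grade 1, which is why two grades are then required. *)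
Lemma filter_not_modular (k : nat) :
  e0 < K -> k <= K.*2.+2 - e0 -> ~ modular k (filter_variety F N).
Proof.
move=> e0_lt k_le [t tP].
have tA e : e < K -> _ :=
  fun eK => tP (filter_algebra F e)
               (@filter_variety_algebra _ F _ _ (leq_trans eK KN)).
pose R i e := ev e (t i) [tuple false; false; false; true].
pose P i e := ev e (t i) [tuple false; false; true; true].
pose Q i e := ev e (t i) [tuple false; true; true; true].
have t0E e x y z w : e < K -> ev e (t 0) [tuple x; y; z; w] = x.
  by move=> /tA[].
have endE x y z w : ev 0 (t k) [tuple x; y; z; w] = w by case: (tA 0 K_gt0).
have xyyx i e x y : e < K -> i <= k -> ev e (t i) [tuple x; y; y; x] = x.
  by move=> /tA[tB _ _ _ _] /tB.
have P_even i e : e < K -> i < k -> ~~ odd i -> P i.+1 e = P i e.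
  by move=> /tA[_ _ tB _ _] ik /(tB _ ik) /(_ false true).
have Q_odd i e : e < K -> i < k -> odd i -> Q i.+1 e = Q i e.
  by move=> /tA[_ _ _ tB _] ik /(tB _ ik) /(_ false true true).
have R_odd i e : e < K -> i < k -> odd i -> R i.+1 e = R i e.
  by move=> /tA[_ _ _ tB _] ik /(tB _ ik) /(_ false false true).
have PQ i e : e0 <= e -> P i e -> Q i e.
  by move=> ee; apply/implyP; apply: (term_mono gF) => //; case; do 4?case.
have RP i e : e0 <= e -> R i e -> P i e.
  by move=> ee; apply/implyP; apply: (term_mono gF) => //; case; do 4?case.
have QR i e : e.+1 < K -> i <= k -> Q i e -> R i e.+1.
  move=> eK ik; apply/implyP.
  have : Q i e && ev 0 (t i) [tuple true; false; false; true] ==> R i e.+1.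
    by apply: (term_meet gF); case; do 4?case.
  by rewrite xyyx // andbT.
have PR i e : e.+1 < K -> i <= k -> P i e -> R i e.+1.
  move=> eK ik; apply/implyP.
  have : P i e && ev 0 (t i) [tuple true; false; false; true] ==> R i e.+1.
    by apply: (term_meet gF); case; do 4?case.
  by rewrite xyyx // andbT.
have Q_start i : i <= k -> i <= 2 -> ~~ Q i K.-1.
  suff Q1 : 0 < k -> ~~ Q 1 K.-1.
    case: i => [|[|[|//]]] ik _;
      [rewrite /Q t0E|exact: Q1|rewrite Q_odd ?Q1] => //; lia.
  move=> k_gt0.
  have xxww : ev 0 (t 1) [tuple true; true; false; false] = true.
    by have [_ _ <- // _ _] := tA 0 K_gt0; apply: t0E.
  have : ~~ [&& Q 1 K.-1, ev 0 (t 1) [tuple true; true; false; false]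
              & ev 0 (t 1) [tuple true; false; false; true]].
    by apply: (term_inter gF) => //; case; do 4?case.
  by rewrite xxww xyyx // !andbT.
have step_P i e m : e < K -> i <= k -> i <= m.+1 -> ~~ odd m ->
    (forall j, j <= k -> j <= m -> ~~ P j e) -> ~~ P i e.
  move=> eK ik im m_even Pm; case: (leqP i m) => [|mi]; first exact: Pm.
  have iE : i = m.+1 by lia.
  by rewrite iE P_even ?Pm //; lia.
have R_late r i : r < K -> e0 <= K.-1 - r -> i <= k -> i <= r.*2.+4 ->
    (forall j, j <= k -> j <= r.*2.+2 -> ~~ Q j (K.-1 - r)) ->
    ~~ R i (K.-1 - r).
  move=> rK e0r ik ir Qr.
  have eK : K.-1 - r < K by lia.
  have Pr j : j <= k -> j <= r.*2.+3 -> ~~ P j (K.-1 - r).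
    move=> jk jr.
    apply: (step_P _ _ r.*2.+2) => //=; first by rewrite odd_double.
    move=> l lk lr; exact: contra (PQ _ _ e0r) (Qr l lk lr).
  case: (leqP i r.*2.+3) => [i_le|i_gt].
    exact: contra (RP _ _ e0r) (Pr i ik i_le).
  have iE : i = r.*2.+3.+1 by lia.
  rewrite iE R_odd //=; [|lia|by rewrite odd_double].
  apply: contra (RP _ _ e0r) (Pr _ _ _) => //; lia.
have Q_late r i : r < K -> i <= k -> i <= r.*2.+2 -> ~~ Q i (K.-1 - r).
  elim: r i => [|r IH] i rK ik ir; first by rewrite subn0; apply: Q_start.
  have Rr : ~~ R i (K.-1 - r).
    apply: R_late => //; [lia..|].
    move=> j jk jr; apply: IH => //; lia.
  apply: contra Rr.
  have <- : (K.-1 - r.+1).+1 = K.-1 - r by lia.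
  apply: QR => //; lia.
case: (posnP e0) => [e0_eq|e0_gt].
  have : ~~ R k (K.-1 - K.-1).
    apply: R_late => //; [lia..|]; move=> j jk jr; apply: Q_late => //; lia.
  by rewrite subnn /R endE.
have : ~~ P k 0.
  apply: (step_P _ _ K.*2) => //; rewrite ?odd_double //; first lia.
  move=> j jk jK; have : ~~ R j (K.-1 - K.-2).
    apply: R_late => //; [lia..|]; move=> l lk lr; apply: Q_late => //; lia.
  apply: contra; have -> : K.-1 - K.-2 = 1 by lia.
  apply: PR => //; lia.
by rewrite /P endE.
Qed.

End LowerBounds.

(** * The two concrete graded filters *)

Definition zeros (n : nat) (a : 'I_n -> bool) : nat := #|[pred i | ~~ a i]|.

Lemma zeros_mono (n : nat) (a b : 'I_n -> bool) :
  (forall i, a i ==> b i) -> zeros b <= zeros a.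
Proof.
move=> ab; apply/subset_leq_card/subsetP => i; rewrite !inE.
by apply: contra; apply/implyP.
Qed.

Lemma zeros_meet (n : nat) (a b c : 'I_n -> bool) :
  (forall i, a i && b i ==> c i) -> zeros c <= zeros a + zeros b.
Proof.
move=> abc; rewrite /zeros -cardUI; apply: leq_trans (leq_addr _ _).
apply/subset_leq_card/subsetP => i; rewrite !inE -negb_and.
by apply: contra; apply/implyP.
Qed.

Lemma zeros_inter (n : nat) (a b c : 'I_n -> bool) :
  (forall i, ~~ [&& a i, b i & c i]) -> n <= zeros a + zeros b + zeros c.
Proof.
move=> abc.
have zF : zeros (fun _ : 'I_n => false) = n by exact: card_ord.
rewrite -[X in X <= _]zF; pose ab i := a i && b i.
apply: leq_trans (@zeros_meet _ ab c _ _) _.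
  by move=> i; rewrite /ab -andbA implybF.
by rewrite leq_add2r; apply: zeros_meet => i; apply/implyP.
Qed.

Lemma zeros_almost_true (n : nat) (a : 'I_n -> bool) (i : 'I_n) :
  (forall j, j != i -> a j) -> zeros a <= 1.
Proof.
move=> ai; rewrite -(card1 i); apply/subset_leq_card/subsetP => j.
by rewrite !inE; apply: contraR => /ai.
Qed.

Lemma zeros_almost_false (n : nat) (a : 'I_n -> bool) (i : 'I_n) :
  (forall j, j != i -> ~~ a j) -> n.-1 <= zeros a.
Proof.
move=> ai; rewrite -[X in X.-1](card_ord n) -(cardC1 i).
by apply/subset_leq_card/subsetP => j; rewrite !inE; apply: ai.
Qed.

Lemma zeros_from (n m : nat) : m <= n -> zeros (fun i : 'I_n => m <= i) = m.
Proof.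
move=> mn; have winj : injective (widen_ord mn).
  by move=> i j eq_ij; apply: val_inj; exact: (congr1 val eq_ij).
rewrite -[RHS]card_ord -(card_imset _ winj).
apply: eq_card => i; rewrite !inE -ltnNge.
apply/idP/imsetP => [im|[j _ ->]]; last by rewrite /= ltn_ord.
by exists (Ordinal im) => //; apply: val_inj.
Qed.

Lemma zeros_below (n m : nat) : zeros (fun i : 'I_n => i < m) = n - m.
Proof.
case: (leqP m n) => [mn|nm]; last first.
  have -> : n - m = 0 by lia.
  by apply: eq_card0 => i; rewrite !inE (ltn_trans (ltn_ord i) nm).
have -> : zeros (fun i : 'I_n => i < m)
          = #|predC [pred i : 'I_n | ~~ (m <= i)]|.
  by apply: eq_card => i; rewrite !inE negbK -leqNgt.
have := cardC [pred i : 'I_n | ~~ (m <= i)]; rewrite card_ord.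
by rewrite [X in X + _](zeros_from mn) => /(congr1 (subn^~ m)); rewrite addKn.
Qed.

(** At most [e + 1] false coordinates, rather than [e]: grade 0 has to contain
    the tuples with a single false coordinate. *)
Definition threshold (n e : nat) (a : 'I_n -> bool) : bool := zeros a <= e.+1.

Lemma threshold_graded (n : nat) : graded_filter (n - 3) 0 (@threshold n).
Proof.
rewrite /threshold; split=> [e a b _ ab|e a b c abc|a b c n3 abc].
- by apply/implyP; apply: leq_trans; apply: zeros_mono.
- have := zeros_meet abc; lia.
- have := zeros_inter abc; lia.
Qed.

(** The first two coordinates are replaced by their conjunction, so that their
    being false counts once. *)
Definition merge (n : nat) (a : 'I_n.+2 -> bool) (j : 'I_n.+1) : bool :=
  (if j == 0 :> nat then a ord0 else true) && a (inord j.+1).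

Definition half_threshold (n e : nat) (a : 'I_n.+2 -> bool) : bool :=
  ((e == 0) ==> (a (inord 1) ==> a ord0)) && threshold e (merge a).

Lemma half_threshold_graded (n : nat) :
  graded_filter (n - 2) 1 (@half_threshold n).
Proof.
rewrite /half_threshold; split=> [e a b e1 ab|e a b c abc|a b c n2 abc].
- have -> : (e == 0) = false by lia.
  apply/(graded_mono (threshold_graded n.+1)) => // j.
  apply/implyP => /andP[a0 a1]; apply/andP; split.
    by case: ifP a0 => // _; apply/implyP.
  exact: (implyP (ab _)).
- have := @graded_meet _ _ _ _ (threshold_graded n.+1) e (merge a) (merge b)
    (merge c).
  case: threshold; rewrite ?andbF // => /(_ _) /implyP; rewrite andTb => H.
  case/boolP : (_ && _) => //; case/andP => _ /andP[_] /H; apply.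
  move=> j; apply/implyP => /andP[/andP[a0 a1] /andP[b0 b1]]; apply/andP; split.
    by case: ifP a0 b0 => // _ a0 b0; apply: (implyP (abc _)); rewrite a0.
  by apply: (implyP (abc _)); rewrite a1.
- have := @graded_inter _ _ _ _ (threshold_graded n.+1) (merge a) (merge b)
    (merge c).
  have -> : n.+1 - 3 = n - 2 by lia.
  move=> /(_ n2) H; apply/and3P => -[/andP[_ ta] /andP[_ tb] /andP[_ tc]].
  suff /H : forall j, ~~ [&& merge a j, merge b j & merge c j].
    by rewrite ta tb tc.
  move=> j; apply: contra (abc (inord j.+1)).
  by rewrite /merge => /and3P[/andP[_ ->] /andP[_ ->] /andP[_ ->]].
Qed.

(** All coordinates but one equal to [x] force the value [x]; this gives the
    near-unanimity identities of both kinds. *)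
Lemma threshold_near (n e : nat) (a : 'I_n -> bool) (i : 'I_n) (x : bool) :
  e.+2 < n -> (forall j, j != i -> a j = x) -> threshold e a = x.
Proof.
rewrite /threshold => en; case: x => ai.
  exact: leq_trans (@zeros_almost_true _ a i ai) _.
have ai' j : j != i -> ~~ a j by move=> /ai ->.
have := zeros_almost_false ai'; lia.
Qed.

Lemma threshold_near_unanimity (n : nat) :
  3 <= n ->
  has_near_unanimity (Whole n) (filter_variety (@threshold n) (n - 2)).
Proof.
move=> n3; exists (basic_term n) => A VA x y i; rewrite evalt_mktuple.
apply: (filter_absorption _ VA) => e eN v; apply: (@threshold_near _ _ _ i).
  lia.
by move=> j /negPf /= ->.
Qed.

Lemma half_threshold_near_unanimity (n : nat) :
  3 <= n ->
  has_near_unanimity (PlusHalf n) (filter_variety (@half_threshold n) (n - 2)).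
Proof.
move=> n3; exists (basic_term n.+2) => A VA x z.
have inE1 : (inord 1 : 'I_n.+2) = 1 :> nat by rewrite inordK.
have mE (j : 'I_n.+1) : (inord j.+1 : 'I_n.+2) = j.+1 :> nat.
  by rewrite inordK // ltnS.
split=> [|i i_gt0|]; rewrite !evalt_mktuple.
- apply: (filter_absorption _ VA) => e eN v.
  rewrite /half_threshold /= inE1 implybb implybT /=.
  apply: (@threshold_near _ _ _ ord0); first lia.
  by move=> j; rewrite /merge -(inj_eq val_inj) /= mE => /negPf jn;
    rewrite jn ltnS ltnS leqn0 jn.
- apply: (filter_absorption _ VA) => e eN v.
  have i0 : (ord0 == i) = false by apply/eqP => i0; move: i_gt0; rewrite -i0.
  rewrite /half_threshold /= i0.
  have iE : (inord i.-1 : 'I_n.+1) = i.-1 :> nat.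
    by rewrite inordK //; have := ltn_ord i; lia.
  have -> : threshold e (merge (v \o eq_op^~ i)) = v false.
    apply: (@threshold_near _ _ _ (inord i.-1)) => [|j]; first lia.
    rewrite -(inj_eq val_inj) /= iE => /eqP ji.
    have i_neq : (inord j.+1 == i) = false.
      by rewrite -(inj_eq val_inj) /= mE; apply/eqP; lia.
    by rewrite /merge /= i0 i_neq; case: ifP => //= _; rewrite andbb.
  by case: (v false); rewrite ?implybT ?andbF.
- apply: (filter_identity _ VA) => e eN v; rewrite /half_threshold /= inE1 /=.
  (* The threshold ignores the exceptional first place; at grade 0 it is the
     other conjunct that rejects the tuple false there only. *)
  have low : threshold e (merge (v \o (fun j : 'I_n.+2 => j < 1)))
             = v false.
    apply: (@threshold_near _ _ _ ord0) => [|j]; first lia.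
    by rewrite /merge -(inj_eq val_inj) /= mE => /negPf ->.
  have high : threshold e (merge (v \o (fun j : 'I_n.+2 => j < 3)))
              = threshold e (fun j : 'I_n.+1 => v (j < 2)).
    congr threshold; apply: functional_extensionality => j.
    by rewrite /merge /= mE; case: ifP => [/eqP ->|_ /=]; rewrite ?andbb.
  rewrite low high; case: (eqVneq (v true) (v false)) => [v_eq|].
    have v_const b : v b = v false by case: b.
    have -> : threshold e (fun j : 'I_n.+1 => v (j < 2)) = v false.
      by apply: (@threshold_near _ _ _ ord0) => [|j _]; [lia|rewrite v_const].
    by rewrite v_eq !implybb.
  have z2 := @zeros_from n.+1 2 (leqW (ltnW n3)).
  case vt : (v true); case vf : (v false) => // _; rewrite /threshold.
    have -> : zeros (fun j : 'I_n.+1 => v (j < 2))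
              = zeros (fun j : 'I_n.+1 => j < 2).
      by apply: eq_card => j; rewrite !inE; case: (j < 2); rewrite ?vt ?vf.
    by rewrite zeros_below andbF; apply/negP => /andP[_]; lia.
  have -> : zeros (fun j : 'I_n.+1 => v (j < 2)) = 2.
    rewrite -[RHS]z2; apply: eq_card => j.
    rewrite !inE; have -> : (1 < j) = ~~ (j < 2) by rewrite -leqNgt.
    by case: (j < 2); rewrite ?vt ?vf.
  by case: e {eN low high} => [|e].
Qed.

(** * Sharpness *)

Lemma distributive1_trivial (S : signature) (V : variety S) (A : algebra S)
    (x z : A) :
  distributive 1 V -> V A -> x = z.
Proof.
case=> t tP VA; have [t0E _ t01 _ t1E] := tP A VA.
by rewrite -(t0E x x z) (t01 0) // t1E.
Qed.

(** A Jonsson chain can be prolonged by repeating its last projection. *)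
Lemma distributive_mono (S : signature) (V : variety S) (k l : nat) :
  k <= l -> distributive k V -> distributive l V.
Proof.
move=> kl [t tP]; exists (fun i => t (minn i k)) => A VA.
have [t0E tx t_even t_odd tkE] := tP A VA.
split=> [x y z|i il x y|i il i_even x z|i il i_odd x z|x y z].
- by rewrite min0n.
- by apply: tx; rewrite geq_minr.
- case: (ltnP i k) => ik; first by rewrite (minn_idPl ik) t_even.
  by rewrite (minn_idPr (leqW ik)).
- case: (ltnP i k) => ik; first by rewrite (minn_idPl ik) t_odd.
  by rewrite (minn_idPr (leqW ik)).
- by rewrite (minn_idPr kl).
Qed.

Lemma near_unanimity_distributive (S : signature) (V : variety S)
    (h : half_nat) :
  6 <= twice h -> has_near_unanimity h V -> distributive (twice h - 4) V.
Proof.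
case: h => n /= hn; first by apply: whole_distributive; lia.
have -> : n.*2.+1 - 4 = n.*2 - 3 by lia.
by apply: half_distributive; lia.
Qed.

Lemma near_unanimity_modular (S : signature) (V : variety S) (h : half_nat) :
  6 <= twice h -> has_near_unanimity h V -> modular (twice h - 3) V.
Proof.
case: h => n /= hn; first by apply: whole_modular; lia.
have -> : n.*2.+1 - 3 = n.*2 - 2 by lia.
by apply: half_modular; lia.
Qed.

(** One variety serves both bounds.  For h = 3 there is no grade left for the
    induction, and it suffices that the variety is not trivial. *)
Lemma near_unanimity_sharp (h : half_nat) :
  6 <= twice h ->
  exists (S : signature) (V : variety S),
    [/\ locally_finite V, has_near_unanimity h V,
        ~ distributive (twice h - 5) V
      & 8 <= twice h -> ~ modular (twice h - 4) V].
Proof.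
case: h => n /= hn.
  exists (one_op n), (filter_variety (@threshold n) (n - 2)); split.
  - exact: filter_variety_locally_finite.
  - by apply: threshold_near_unanimity; lia.
  - case: (eqVneq n 3) => [n3|n_neq].
      have -> : n.*2 - 5 = 1 by lia.
      move=> D; have lt0 : 0 < n - 2 by lia.
      have := @distributive1_trivial _ _ (filter_algebra (@threshold n) 0)
                true false D.
      by move=> /(_ (@filter_variety_algebra _ _ _ _ lt0)).
    by apply: (filter_not_distributive (threshold_graded n)) => //; lia.
  - by move=> h8; apply: (filter_not_modular (threshold_graded n)) => //; lia.
exists (one_op n.+2), (filter_variety (@half_threshold n) (n - 2)); split.
- exact: filter_variety_locally_finite.
- by apply: half_threshold_near_unanimity; lia.
- by apply: (filter_not_distributive (half_threshold_graded n)) => //; lia.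
- move=> h8.
  by apply: (filter_not_modular (half_threshold_graded n)) => //; lia.
Qed.

Theorem theorem1p1 (h k : half_nat) (hh : 6 <= twice h) (hk : 6 <= twice k) :
  (twice h < twice k ->
     (forall (S : signature) (V : variety S),
        has_near_unanimity h V -> has_near_unanimity k V) /\
     (exists (S : signature) (V : variety S),
        [/\ locally_finite V, has_near_unanimity k V
          & ~ has_near_unanimity h V])) /\
  ((forall (S : signature) (V : variety S),
      has_near_unanimity h V -> distributive (twice h - 4) V) /\
   (exists (S : signature) (V : variety S),
      [/\ locally_finite V, has_near_unanimity h V
        & ~ distributive (twice h - 5) V])) /\
  ((forall (S : signature) (V : variety S),
      has_near_unanimity h V -> modular (twice h - 3) V) /\
   (8 <= twice h ->
    exists (S : signature) (V : variety S),
      [/\ locally_finite V, has_near_unanimity h V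
        & ~ modular (twice h - 4) V])).
Proof.
have [S [V [lfV nuV not_dist not_mod]]] := near_unanimity_sharp hh.
split; last split.
- move=> hk_lt; split=> [S' V'|].
    by apply: near_unanimity_weaken; lia.
  have [S' [V' [lfV' nuV' not_dist' _]]] := near_unanimity_sharp hk.
  exists S', V'; split=> // /(near_unanimity_distributive hh) D.
  by apply: not_dist'; apply: distributive_mono D; lia.
- split=> [S' V'|]; first exact: near_unanimity_distributive.
  by exists S, V.
- split=> [S' V'|h8]; first exact: near_unanimity_modular.
  by exists S, V; split=> //; apply: not_mod.
Qed.
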